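(* $(k\langle A\rangle,*,\Delta)$ and $(k\langle A\rangle,\star,\Delta)$ are Hopf algebras, with respective antipodes $S_*=\Sigma T R$ and $S_\star=T\Sigma R$ (compositions of linear maps).
   Context: Let $k$ be a field containing $\mathbb{Q}$, $A$ a countable set of ''letters'', $kA$ the $k$-vector space with basis $A$, and $\diamond$ an associative and commutative $k$-bilinear product on $kA$. Let $k\langle A\rangle$ be the noncommutative polynomial algebra over $A$: the $k$-vector space with basis the words $a_1a_2\cdots a_n$ ($a_i\in A$, $n\ge 0$), with concatenation product; $\ell(a_1\cdots a_n)=n$, and $1$ is the empty word. The $k$-bilinear products $*$ and $\star$ on $k\langle A\rangle$ are defined by requiring $1$ to be the identity element for each and, for all $a,b\in A$ and words $w,v$, $$aw*bv=a(w*bv)+b(aw*v)+(a\diamond b)(w*v),\qquad aw\star bv=a(w\star bv)+b(aw\star v)-(a\diamond b)(w\star v).$$ The coproduct is $\Delta(w)=\sum_{uv=w}u\otimes v$ for words $w$, the sum being over all pairs $(u,v)$ of words with $uv=w$ (including $(1,w)$ and $(w,1)$). The unit is $1$ and the counit is $\epsilon(1)=1$, $\epsilon(w)=0$ for $\ell(w)>0$. A composition of $n$ is a sequence $I=(i_1,\dots,i_m)$ of positive integers with sum $n$; $\mathcal{C}(n)$ is the set of these. For a word $w=a_1\cdots a_n$ and $I=(i_1,\dots,i_m)\in\mathcal{C}(n)$, put $I[w]=(a_1\diamond\cdots\diamond a_{i_1})(a_{i_1+1}\diamond\cdots\diamond a_{i_1+i_2})\cdots(a_{i_1+\cdots+i_{m-1}+1}\diamond\cdots\diamond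 a_n)$. The linear maps $\Sigma,T,R:k\langle A\rangle\to k\langle A\rangle$ are given by $\Sigma(1)=T(1)=R(1)=1$ and, for nonempty words, $\Sigma(w)=\sum_{I\in\mathcal{C}(\ell(w))}I[w]$, $T(w)=(-1)^{\ell(w)}w$, and $R(a_1a_2\cdots a_n)=a_na_{n-1}\cdots a_1$. *)

(* Defs.v *)
From HB Require Import structures.
From mathcomp Require Import all_boot all_order all_algebra.
From mathcomp Require Import finmap.
From mathcomp.multinomials Require Import monalg.

Set Implicit Arguments.
Unset Strict Implicit.
Unset Printing Implicit Defensive.

Import GRing.Theory.
Local Open Scope ring_scope.

Section FreeModules.
Context {k : fieldType}.

Definition lin_ext (B : choiceType) (V : lmodType k) (f : B -> V)
    (x : {malg k[B]}) : V :=
  \sum_(b <- msupp x) x@_b *: f b.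

(* All spaces here are free on a given basis; the tensor product of the      *)
(* spaces with bases B and C is the space with basis B * C, the basis        *)
(* element (b, c) standing for b (x) c (see tensor_universal).               *)
Definition tensor (B C : choiceType) (x : {malg k[B]}) (y : {malg k[C]}) :
    {malg k[(B * C)%type]} :=
  lin_ext (fun b => lin_ext (fun c => << (b, c) >>) y) x.

Definition tensor_map (B C B' C' : choiceType)
    (f : {malg k[B]} -> {malg k[B']}) (g : {malg k[C]} -> {malg k[C']}) :
    {malg k[(B * C)%type]} -> {malg k[(B' * C')%type]} :=
  lin_ext (fun p => tensor (f << p.1 >>) (g << p.2 >>)).

Definition tensor_ind (B C : choiceType) (V : lmodType k)
    (f : {malg k[B]} -> {malg k[C]} -> V) : {malg k[(B * C)%type]} -> V :=
  lin_ext (fun p => f << p.1 >> << p.2 >>).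

Definition tensor_assoc (B C D : choiceType) :
    {malg k[((B * C) * D)%type]} -> {malg k[(B * (C * D))%type]} :=
  lin_ext (fun p => << (p.1.1, (p.1.2, p.2)) >>).

(* (x (x) y) (x' (x) y') = m x x' (x) m y y' *)
Definition tensor_mul (B : choiceType)
    (m : {malg k[B]} -> {malg k[B]} -> {malg k[B]})
    (s t : {malg k[(B * B)%type]}) : {malg k[(B * B)%type]} :=
  lin_ext (fun p => lin_ext (fun q =>
    tensor (m << p.1 >> << q.1 >>) (m << p.2 >> << q.2 >>)) t) s.

Section Hopf.
Context {B : choiceType}.
Local Notation H := {malg k[B]}.
Local Notation HH := {malg k[(B * B)%type]}.

Record is_algebra (m : H -> H -> H) (e : H) : Prop := IsAlgebra {
  alg_linearl : forall y, linear (m^~ y);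
  alg_linearr : forall x, linear (m x);
  alg_assoc : associative m;
  alg_unitl : left_id e m;
  alg_unitr : right_id e m }.

(* The counit laws use the identifications k (x) H = H = H (x) k.            *)
Record is_coalgebra (Delta : H -> HH) (eps : H -> k) : Prop := IsCoalgebra {
  coalg_comul_linear : linear Delta;
  coalg_counit_linear : scalar eps;
  coalg_coassoc : forall x,
    tensor_assoc (tensor_map Delta id (Delta x))
    = tensor_map id Delta (Delta x);
  coalg_counitl : forall x, tensor_ind (fun y z => eps y *: z) (Delta x) = x;
  coalg_counitr : forall x, tensor_ind (fun y z => eps z *: y) (Delta x) = x }.

Record is_bialgebra (m : H -> H -> H) (e : H) (Delta : H -> HH)
    (eps : H -> k) : Prop := IsBialgebra {
  bialg_algebra : is_algebra m e;
  bialg_coalgebra : is_coalgebra Delta eps;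
  bialg_comulM : forall x y, Delta (m x y) = tensor_mul m (Delta x) (Delta y);
  bialg_comul1 : Delta e = tensor e e;
  bialg_counitM : forall x y, eps (m x y) = eps x * eps y;
  bialg_counit1 : eps e = 1 }.

Record is_hopf_algebra (m : H -> H -> H) (e : H) (Delta : H -> HH)
    (eps : H -> k) (S : H -> H) : Prop := IsHopfAlgebra {
  hopf_bialgebra : is_bialgebra m e Delta eps;
  hopf_antipode_linear : linear S;
  hopf_antipodel : forall x,
    tensor_ind m (tensor_map S id (Delta x)) = eps x *: e;
  hopf_antipoder : forall x,
    tensor_ind m (tensor_map id S (Delta x)) = eps x *: e }.

End Hopf.
End FreeModules.

Fixpoint compositions (n : nat) : seq (seq nat) :=
  if n is n'.+1 then
    [seq 1%N :: J | J <- compositions n'] ++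
    flatten [seq if J is i :: J' then [:: i.+1 :: J'] else [::]
            | J <- compositions n']
  else [:: [::]].

Section QuasiShuffle.
Context {k : fieldType} {A : countType}.
Variable dia : {malg k[A]} -> {malg k[A]} -> {malg k[A]}.

(* The noncommutative polynomial algebra: the monoid algebra of the free     *)
(* monoid on A; its ring product is concatenation.                           *)
Local Notation kA := {malg k[A]}.
Local Notation kw := {malg k[{fmonom A}]}.

Definition letters : kA -> kw := lin_ext (fun a => << fmu a >>).

(* Both products at once: the sign c of the last term is 1 or -1.            *)
Fixpoint qshuffle (c : k) (w : seq A) {struct w} : seq A -> kw :=
  if w is a :: w' then
    fix qshuffle_a (v : seq A) : kw :=
      if v is b :: v' then
        << fmu a >> * qshuffle c w' v + << fmu b >> * qshuffle_a v'
        + c *: (letters (dia << a >> << b >>) * qshuffle c w' v')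
      else << FMonom w >>
  else fun v => << FMonom v >>.

Definition word_bilin (f : seq A -> seq A -> kw) (x y : kw) : kw :=
  lin_ext (fun w : {fmonom A} => lin_ext (fun v : {fmonom A} => f w v) y) x.

Definition qs_ast : kw -> kw -> kw := word_bilin (qshuffle 1).
Definition qs_star : kw -> kw -> kw := word_bilin (qshuffle (-1)).

Definition block (s : seq A) : kA :=
  if s is a :: s' then foldl (fun x b => dia x << b >>) << a >> s' else 0.

(* I[w]: reshape cuts w into consecutive blocks of lengths I. *)
Definition comp_act (I : seq nat) (w : seq A) : kw :=
  \prod_(s <- reshape I w) letters (block s).

Definition qs_Sigma : kw -> kw :=
  lin_ext (fun w : {fmonom A} => \sum_(I <- compositions (size w)) comp_act I w).

End QuasiShuffle.

Section WordMaps.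
Context {k : fieldType} {A : countType}.
Local Notation kw := {malg k[{fmonom A}]}.

Definition deconc : kw -> {malg k[({fmonom A} * {fmonom A})%type]} :=
  lin_ext (fun w : {fmonom A} =>
    \sum_(i < (size w).+1) << (FMonom (take i w), FMonom (drop i w)) >>).

Definition word_counit (x : kw) : k := x@_mone.

Definition qs_T : kw -> kw :=
  lin_ext (fun w : {fmonom A} => (-1) ^+ size w *: << w >>).

Definition qs_R : kw -> kw :=
  lin_ext (fun w : {fmonom A} => << FMonom (rev w) >>).

End WordMaps.

Section FreeModuleTheory.
Context {k : fieldType}.

Lemma lin_extU (B : choiceType) (V : lmodType k) (f : B -> V) b :
  lin_ext f << b >> = f b.
Proof.
by rewrite /lin_ext msuppU oner_eq0 big_seq_fset1 mcoeffUU scale1r.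
Qed.

Lemma lin_extEw (B : choiceType) (V : lmodType k) (f : B -> V)
    (d : {fset B}) x :
  (msupp x `<=` d)%fset -> lin_ext f x = \sum_(b <- d) x@_b *: f b.
Proof.
move=> le; rewrite /lin_ext (big_fset_incl _ le) //= => b _ /mcoeff_outdom ->.
by rewrite scale0r.
Qed.

Lemma lin_ext_linear (B : choiceType) (V : lmodType k) (f : B -> V) :
  linear (lin_ext f).
Proof.
move=> c x y; pose d := (msupp (c *: x + y) `|` (msupp x `|` msupp y))%fset.
have dxy : (msupp x `|` msupp y `<=` d)%fset by apply: fsubsetUr.
have dx : (msupp x `<=` d)%fset := fsubset_trans (fsubsetUl _ _) dxy.
have dy : (msupp y `<=` d)%fset := fsubset_trans (fsubsetUr _ _) dxy.
rewrite (lin_extEw f (fsubsetUl _ _ : msupp (c *: x + y) `<=` d)%fset).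
rewrite (lin_extEw f dx) (lin_extEw f dy).
rewrite scaler_sumr -big_split /=; apply: eq_bigr => b _.
by rewrite mcoeffD mcoeffZ scalerDl scalerA.
Qed.

Lemma lin_ext_uniq (B : choiceType) (V : lmodType k) (f : {malg k[B]} -> V) :
  linear f -> forall x, f x = lin_ext (fun b => f << b >>) x.
Proof.
move=> lf x; have f0 : f 0 = 0.
  by have := lf (-1) 0 0; rewrite scaler0 addr0 scaleN1r addNr.
have fD u v : f (u + v) = f u + f v by have := lf 1 u v; rewrite !scale1r.
have fZ c u : f (c *: u) = c *: f u by have := lf c u 0; rewrite f0 !addr0.
rewrite {1}[x]monalgE (big_morph f fD f0); apply: eq_bigr => b _.
rewrite -fZ; congr f; apply/malgP => b'.
by rewrite mcoeffZ !mcoeffU mulrnAr mulr1.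
Qed.

Lemma tensor_linearl (B C : choiceType) (y : {malg k[C]}) :
  linear ((@tensor k B C)^~ y).
Proof. exact: lin_ext_linear. Qed.

Lemma tensor_linearr (B C : choiceType) (x : {malg k[B]}) :
  linear (@tensor k B C x).
Proof.
move=> c y z; rewrite /tensor /lin_ext scaler_sumr -big_split /=.
apply: eq_bigr => b _; rewrite -!/(lin_ext _ _) lin_ext_linear.
by rewrite scalerDr !scalerA mulrC.
Qed.

Lemma tensor_universal (B C : choiceType) (V : lmodType k)
    (f : {malg k[B]} -> {malg k[C]} -> V) :
  (forall y, linear (f^~ y)) -> (forall x, linear (f x)) ->
  [/\ linear (tensor_ind f),
      forall x y, tensor_ind f (tensor x y) = f x y
    & forall g, linear g -> (forall x y, g (tensor x y) = f x y) ->
      g =1 tensor_ind f].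
Proof.
move=> fl fr.
have ind b c : tensor_ind f (tensor << b >> << c >>) = f << b >> << c >>.
  by rewrite /tensor !lin_extU /tensor_ind lin_extU.
split; first exact: lin_ext_linear.
- move=> x y; pose g1 u := tensor_ind f (tensor u y).
  have lg1 : linear g1.
    by move=> c u v; rewrite /g1 tensor_linearl /tensor_ind lin_ext_linear.
  rewrite -/(g1 x) (lin_ext_uniq lg1) (lin_ext_uniq (fl y)).
  apply: eq_bigr => b _; congr (_ *: _); rewrite /g1.
  pose g2 u := tensor_ind f (tensor << b >> u).
  have lg2 : linear g2.
    by move=> c u v; rewrite /g2 tensor_linearr /tensor_ind lin_ext_linear.
  rewrite -/(g2 y) (lin_ext_uniq lg2) (lin_ext_uniq (fr << b >>)).
  by apply: eq_bigr => c _; rewrite /g2 ind.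
- move=> g lg gE t; rewrite (lin_ext_uniq lg); apply: eq_bigr => -[b c] _.
  by rewrite /= -gE /tensor !lin_extU.
Qed.

End FreeModuleTheory.

Lemma mem_compositions n I :
  (I \in compositions n) = (0%N \notin I) && (sumn I == n).
Proof.
elim: n I => [|n IHn] [|i J]; rewrite /= ?mem_cat ?inE.
- by [].
- by case: i => [|i]; rewrite //= andbF.
- by apply/negbTE/norP; split; [apply/mapP=> -[] | apply/flatten_mapP=> -[[|? ?]]].
apply/orP/andP.
- case=> [/mapP[J' + [-> ->]]|/flatten_mapP[[|i' J'] +]] //; rewrite IHn.
    by case/andP=> ? /eqP ->.
  rewrite !inE => /andP[/norP[_ nJ] /eqP <-] /eqP[-> ->].
  by rewrite nJ.
- case; case: i => [|[|i]] //= nJ /eqP[E].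
    by left; apply/mapP; exists J; rewrite // IHn nJ -E eqxx.
  right; apply/flatten_mapP; exists (i.+1 :: J); last by rewrite inE.
  by rewrite IHn inE (negbTE nJ) -E /=.
Qed.

Lemma compositions_uniq n : uniq (compositions n).
Proof.
elim: n => //= n IHn; rewrite cat_uniq map_inj_uniq ?IHn => [|I J [->]] //=.
apply/andP; split.
  apply/hasPn => I /flatten_mapP[[|i J]]; rewrite ?inE // => + /eqP ->.
  rewrite mem_compositions inE => /andP[+ _]; case: i => // i _.
  by apply/mapP=> -[].
elim: (compositions n) IHn => //= I s IHs /andP[Is /IHs us].
case: I Is => [|i J] //= Is; rewrite us andbT.
apply/flatten_mapP => -[[|i' J']] //; rewrite ?inE // => Is' /eqP[E1 E2].
by move: Is; rewrite E1 E2 Is'.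
Qed.

Section QuasiShuffleTheory.
Context {k : fieldType} {A : countType}.
Variable dia : {malg k[A]} -> {malg k[A]} -> {malg k[A]}.
Local Notation kw := {malg k[{fmonom A}]}.
Local Notation ltr a := (<< fmu a >> : kw).
Local Notation wd w := (<< FMonom w >> : kw).

Lemma word_one : 1 = wd [::].
Proof. by rewrite -fmoneE. Qed.

Lemma word_cons (a : A) w : ltr a * wd w = wd (a :: w).
Proof.
rewrite malgM_def fgmulUU mul1r; congr << _ >>.
by rewrite /mmul /= fmmulE fmuE.
Qed.

Lemma word_bilinU (f : seq A -> seq A -> kw) w v :
  word_bilin f (wd w) (wd v) = f w v.
Proof. by rewrite /word_bilin !lin_extU. Qed.

Lemma qshuffle1w c w : qshuffle dia c [::] w = wd w.
Proof. by []. Qed.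

Lemma qshufflew1 c w : qshuffle dia c w [::] = wd w.
Proof. by case: w. Qed.

Lemma word_bilin1x (f : seq A -> seq A -> kw) :
  (forall w, f [::] w = wd w) -> left_id 1 (word_bilin f).
Proof.
move=> f1 x; rewrite word_one /word_bilin lin_extU.
have idl : linear (@id kw) by [].
by rewrite [RHS](lin_ext_uniq idl); apply: eq_bigr => w _; rewrite f1 fmK.
Qed.

Lemma word_bilinx1 (f : seq A -> seq A -> kw) :
  (forall w, f w [::] = wd w) -> right_id 1 (word_bilin f).
Proof.
move=> f1 x; have idl : linear (@id kw) by [].
rewrite [RHS](lin_ext_uniq idl); apply: eq_bigr => w _; congr (_ *: _).
by rewrite word_one lin_extU f1 fmK.
Qed.

Lemma qs_ast1x : left_id 1 (qs_ast dia).
Proof. exact/word_bilin1x/qshuffle1w. Qed.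

Lemma qs_astx1 : right_id 1 (qs_ast dia).
Proof. exact/word_bilinx1/qshufflew1. Qed.

Lemma qs_astE a b w v :
  qs_ast dia (ltr a * wd w) (ltr b * wd v) =
    ltr a * qs_ast dia (wd w) (ltr b * wd v)
    + ltr b * qs_ast dia (ltr a * wd w) (wd v)
    + letters (dia << a >> << b >>) * qs_ast dia (wd w) (wd v).
Proof. by rewrite !word_cons /qs_ast !word_bilinU /= scale1r. Qed.

Lemma qs_star1x : left_id 1 (qs_star dia).
Proof. exact/word_bilin1x/qshuffle1w. Qed.

Lemma qs_starx1 : right_id 1 (qs_star dia).
Proof. exact/word_bilinx1/qshufflew1. Qed.

Lemma qs_starE a b w v :
  qs_star dia (ltr a * wd w) (ltr b * wd v) =
    ltr a * qs_star dia (wd w) (ltr b * wd v)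
    + ltr b * qs_star dia (ltr a * wd w) (wd v)
    - letters (dia << a >> << b >>) * qs_star dia (wd w) (wd v).
Proof. by rewrite !word_cons /qs_star !word_bilinU /= scaleN1r. Qed.

Lemma qs_Sigma1 : qs_Sigma dia 1 = 1.
Proof.
by rewrite word_one /qs_Sigma lin_extU big_seq1 /comp_act big_nil -word_one.
Qed.

End QuasiShuffleTheory.

(* Main.v *)
Require Import Defs.
From HB Require Import structures.
From mathcomp Require Import all_boot all_order all_algebra.
From mathcomp Require Import ssrAC finmap.
From mathcomp.multinomials Require Import monalg.
Import GRing.Theory.
Local Open Scope ring_scope.
Set Implicit Arguments.
Unset Strict Implicit.
Unset Printing Implicit Defensive.

(** The two products differ only in the sign c in front of the letter a <> b
(here <> is the product of letters), so both are treated at once.  Write x u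
for the word u prefixed by a linear combination x of letters, and . for the
product with sign c.  Everything is governed by two prefix rules, linear in
every argument:

  (x u) . (y v) = x (u . y v) + y (x u . v) + c (x <> y) (u . v),
  Delta (x u)   = (x (x) 1) Delta u + 1 (x) x u.

Associativity ([mA]), coassociativity ([prefix_rules_coalgebra]) and
multiplicativity of Delta ([DeltaM]) follow by induction on words: expand both
sides with the prefix rules, sort the terms by their first letter, and use the
induction hypotheses on what follows that letter.

For the antipode, put S(a_1 ... a_n) = (-1)^n sum_I c^(n - l(I)) I[a_n ... a_1],
with l(I) the number of parts of I, and let D(x, a_1 ... a_i, v) be the sum
over j <= i of the terms

  - (-c)^(i - j) (a_(j+1) <> ... <> a_i <> x) (S(a_1 ... a_j) . v).

Splitting off the first block shows S(a_1 ... a_i x) = D(x, a_1 ... a_i, 1),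
and the prefix rule for the product gives ([antipode_rev_lcons])

  S(a_1 ... a_i) . y v = D(a_i, a_1 ... a_(i-1), y v) - D(y, a_1 ... a_i, v).

Hence the sum of S(u) . v over all factorizations u v of a nonempty word
telescopes to 0 ([conv_antipode_rev]): S is a left convolution inverse of the
identity.  As the empty word is the only one of length 0, a left convolution
inverse is also a right one ([conv_left_inverse]).

Finally, Sigma obeys a recursion on the first block ([qs_Sigma_cons]), which
shows that S is Sigma T R when c = 1 and T Sigma R when c = -1; commutativity
of <> is used to read the blocks of a word backwards. *)

(** * Linear maps on free modules *)

Section Linearity.
Context {k : fieldType}.
Implicit Types U V W : lmodType k.

Lemma linear_comp U V W (g : V -> W) (f : U -> V) :
  linear g -> linear f -> linear (fun x => g (f x)).
Proof. by move=> lg lf c x y; rewrite lf lg. Qed.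

Lemma linear_add U V (f g : U -> V) :
  linear f -> linear g -> linear (fun x => f x + g x).
Proof. by move=> lf lg c x y; rewrite lf lg scalerDr addrACA. Qed.

Lemma linear_scale U V (c : k) (f : U -> V) :
  linear f -> linear (fun x => c *: f x).
Proof. by move=> lf d x y; rewrite lf scalerDr !scalerA mulrC. Qed.

Lemma linear_scalel U V (f : U -> k) (v : V) :
  scalar f -> linear (fun x => f x *: v).
Proof. by move=> lf d x y; rewrite lf scalerDl -scalerA. Qed.

Lemma linear_id U : linear (fun x : U => x). Proof. by []. Qed.

Lemma linear_big_sum U V I (r : seq I) (f : I -> U -> V) :
  (forall i, linear (f i)) -> linear (fun x => \sum_(i <- r) f i x).
Proof.
move=> lf c x y; rewrite scaler_sumr -big_split.
by apply: eq_bigr => i _; rewrite lf.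
Qed.

Lemma eq_linear (B : choiceType) V (f g : {malg k[B]} -> V) :
  linear f -> linear g -> (forall b, f << b >> = g << b >>) -> f =1 g.
Proof.
move=> lf lg fg x; rewrite (lin_ext_uniq lf) (lin_ext_uniq lg).
by apply: eq_bigr => b _; rewrite fg.
Qed.

Lemma eq_bilinear (B C : choiceType) V (f g : {malg k[B]} -> {malg k[C]} -> V) :
  (forall y, linear (f^~ y)) -> (forall x, linear (f x)) ->
  (forall y, linear (g^~ y)) -> (forall x, linear (g x)) ->
  (forall b c, f << b >> << c >> = g << b >> << c >>) -> f =2 g.
Proof.
move=> fl fr gl gr fg x y.
apply: (eq_linear (f := f^~ y) (g := g^~ y)) => // b.
by apply: (eq_linear (f := f _) (g := g _)).
Qed.

Lemma lin_ext2_bilinear (B C : choiceType) V (f : B -> C -> V) :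
  bilinear_for *:%R *:%R (fun (x : {malg k[B]}) (y : {malg k[C]}) =>
    lin_ext (fun b => lin_ext (f b) y) x).
Proof.
split=> [y|x]; first exact: lin_ext_linear.
rewrite /lin_ext; apply: linear_big_sum => b; apply: linear_scale.
exact: lin_ext_linear.
Qed.

HB.instance Definition _ (B : choiceType) V (f : B -> V) :=
  GRing.isLinear.Build k {malg k[B]} V *:%R (lin_ext f) (lin_ext_linear f).

End Linearity.

(** Proves that a composite of sums, scalings and declared or assumed linear
and bilinear maps is linear in its argument. *)
Ltac linearity := repeat match goal with
  | |- GRing.linear_for _ (fun x => x) => exact: linear_id
  | |- GRing.linear_for _ (fun x => @?f x + @?g x) =>
    apply: (@linear_add _ _ _ f g)
  | |- GRing.linear_for _ (fun x => ?c *: @?f x) =>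
    apply: (@linear_scale _ _ _ c f)
  | |- GRing.linear_for _ (fun x => ?h (@?f x)) =>
    apply: (@linear_comp _ _ _ _ h f);
    [by first [assumption
              | move=> ? ? ?; first [exact: linearPr | exact: linearP]] |]
  | |- GRing.linear_for _ (fun x => ?h (@?f x) ?y) =>
    apply: (@linear_comp _ _ _ _ (fun z => h z y) f);
    [by move=> ? ? ?; exact: linearPl |]
  | |- GRing.linear_for _ ?h =>
    by move=> ? ? ?; first [exact: linearPr | exact: linearP]
  end.

(** * Tensor products *)

Section Tensors.
Context {k : fieldType}.
Implicit Types (B C D : choiceType).

Lemma tensor_bilinear B C : bilinear_for *:%R *:%R (@tensor k B C).
Proof. by split=> x; [apply: tensor_linearl | apply: tensor_linearr]. Qed.
HB.instance Definition _ B C :=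
  bilinear_isBilinear.Build k {malg k[B]} {malg k[C]}
    {malg k[(B * C)%type]} *:%R *:%R (@tensor k B C) (@tensor_bilinear B C).
HB.instance Definition _ B C B' C' (f : {malg k[B]} -> {malg k[B']})
    (g : {malg k[C]} -> {malg k[C']}) :=
  GRing.isLinear.Build k _ _ *:%R (tensor_map f g) (lin_ext_linear _).
HB.instance Definition _ B C (V : lmodType k)
    (f : {malg k[B]} -> {malg k[C]} -> V) :=
  GRing.isLinear.Build k _ _ *:%R (tensor_ind f) (lin_ext_linear _).
HB.instance Definition _ B C D :=
  GRing.isLinear.Build k _ _ *:%R (@tensor_assoc k B C D) (lin_ext_linear _).
HB.instance Definition _ B (m : {malg k[B]} -> {malg k[B]} -> {malg k[B]}) :=
  bilinear_isBilinear.Build k _ _ _ *:%R *:%R (tensor_mul m)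
    (lin_ext2_bilinear _).

Lemma tensorU B C (b : B) (c : C) :
  tensor << b >> << c >> = << (b, c) >> :> {malg k[(B * C)%type]}.
Proof. by rewrite /tensor !lin_extU. Qed.

Lemma eq_linear_tensor B C (V : lmodType k)
    (f g : {malg k[(B * C)%type]} -> V) :
  linear f -> linear g ->
  (forall b c, f (tensor << b >> << c >>) = g (tensor << b >> << c >>)) ->
  f =1 g.
Proof. by move=> lf lg fg; apply: eq_linear => // -[b c]; rewrite -tensorU. Qed.

Lemma tensor_indE B C (V : lmodType k)
    (f : {bilinear {malg k[B]} -> {malg k[C]} -> V}) x y :
  tensor_ind f (tensor x y) = f x y.
Proof.
have [] // := @tensor_universal k B C V f; move=> z c u v.
  by rewrite linearPl.
by rewrite linearPr.
Qed.

Lemma tensor_mapE B C B' C' (f : {malg k[B]} -> {malg k[B']})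
    (g : {malg k[C]} -> {malg k[C']}) x y :
  linear f -> linear g -> tensor_map f g (tensor x y) = tensor (f x) (g y).
Proof.
move=> lf lg; move: x y; apply: eq_bilinear => [y|x|y|x|b c];
  [linearity|linearity|linearity|linearity|].
by rewrite tensorU /tensor_map lin_extU.
Qed.

Lemma tensor_assocE B C D
    (x : {malg k[B]}) (y : {malg k[C]}) (z : {malg k[D]}) :
  tensor_assoc (tensor (tensor x y) z) = tensor x (tensor y z).
Proof.
move: x y; apply: eq_bilinear => [y|x|y|x|b c];
  [linearity|linearity|linearity|linearity|].
move: z; apply: eq_linear; [linearity|linearity|].
by move=> d; rewrite !tensorU /tensor_assoc lin_extU.
Qed.

Lemma tensor_mulE B (m : {bilinear {malg k[B]} -> {malg k[B]} -> {malg k[B]}})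
    x y x' y' :
  tensor_mul m (tensor x y) (tensor x' y') = tensor (m x x') (m y y').
Proof.
move: x y; apply: eq_bilinear => [y|x|y|x|b c];
  [linearity|linearity|linearity|linearity|].
move: x' y'; apply: eq_bilinear => [y|x|y|x|b' c'];
  [linearity|linearity|linearity|linearity|].
by rewrite !tensorU /tensor_mul !lin_extU.
Qed.

End Tensors.

(** * Hopf algebras governed by the prefix rules *)

Section PrefixRules.
Context {k : fieldType} {B I : choiceType}.
Local Notation X := {malg k[I]}.
Local Notation H := {malg k[B]}.
Local Notation HH := {malg k[(B * B)%type]}.
(* H is spanned by the words; lcons x u is the word u prefixed by x. *)
Variables (lcons : X -> H -> H) (e : H) (word : seq I -> H).
Hypothesis lcons_bilinear : bilinear_for *:%R *:%R lcons.
HB.instance Definition _ :=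
  bilinear_isBilinear.Build k X H H *:%R *:%R lcons lcons_bilinear.
Hypothesis word_nil : word [::] = e.
Hypothesis word_cons : forall a w, word (a :: w) = lcons << a >> (word w).
Hypothesis word_span : forall b, exists w, << b >> = word w.

Lemma eq_linear_words (V : lmodType k) (f g : H -> V) :
  linear f -> linear g -> (forall w, f (word w) = g (word w)) -> f =1 g.
Proof.
by move=> lf lg fg; apply: eq_linear => // b; have [w ->] := word_span b.
Qed.

Lemma eq_bilinear_words (V : lmodType k) (f g : H -> H -> V) :
  (forall y, linear (f^~ y)) -> (forall x, linear (f x)) ->
  (forall y, linear (g^~ y)) -> (forall x, linear (g x)) ->
  (forall u v, f (word u) (word v) = g (word u) (word v)) -> f =2 g.
Proof.
move=> fl fr gl gr fg; apply: eq_bilinear => // b c.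
by have [u ->] := word_span b; have [v ->] := word_span c.
Qed.

Lemma eq_bilinear_lcons (V : lmodType k) (f g : X -> H -> V) :
  (forall y, linear (f^~ y)) -> (forall x, linear (f x)) ->
  (forall y, linear (g^~ y)) -> (forall x, linear (g x)) ->
  (forall a v, f << a >> (word v) = g << a >> (word v)) -> f =2 g.
Proof.
move=> fl fr gl gr fg; apply: eq_bilinear => // a c.
by have [v ->] := word_span c.
Qed.

Section Coproduct.
Variables (Delta : H -> HH) (eps : H -> k).
Hypothesis Delta_linear : linear Delta.
HB.instance Definition _ := GRing.isLinear.Build k H HH *:%R Delta Delta_linear.

(** Prefixing the left tensor factor: the left multiplication by x (x) 1 for
concatenation. *)
Definition lcons_tensor (x : X) : HH -> HH := tensor_map (lcons x) id.

Lemma lcons_tensorE x u v : lcons_tensor x (tensor u v) = tensor (lcons x u) v.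
Proof. by apply: tensor_mapE; linearity. Qed.

Lemma lcons_tensor_bilinear : bilinear_for *:%R *:%R lcons_tensor.
Proof.
split=> [s d x y|x]; last exact: lin_ext_linear.
move: s; apply: eq_linear_tensor => [||u v]; first exact: lin_ext_linear.
  apply: linear_add; [apply: linear_scale|]; exact: lin_ext_linear.
by rewrite !lcons_tensorE !linearPl.
Qed.
HB.instance Definition _ :=
  bilinear_isBilinear.Build k X HH HH *:%R *:%R lcons_tensor
    lcons_tensor_bilinear.

Hypothesis Delta1 : Delta e = tensor e e.
Hypothesis Delta_word_cons : forall a w,
  Delta (word (a :: w)) =
    lcons_tensor << a >> (Delta (word w)) + tensor e (word (a :: w)).
Hypothesis eps_linear : scalar eps.
Hypothesis eps1 : eps e = 1.
Hypothesis eps_word_cons : forall a w, eps (word (a :: w)) = 0.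

Lemma Delta_lcons x u :
  Delta (lcons x u) = lcons_tensor x (Delta u) + tensor e (lcons x u).
Proof.
move: x u; apply: eq_bilinear_lcons => [u|x|u|x|a w];
  [linearity|linearity|linearity|linearity|].
by rewrite -word_cons Delta_word_cons.
Qed.

Lemma eps_lcons x u : eps (lcons x u) = 0.
Proof.
move: x u; apply: (@eq_bilinear_lcons k^o (fun x u => eps (lcons x u))
    (fun _ _ => 0)) => [u|x|u|x|a w].
- by move=> d x y; rewrite linearPl eps_linear.
- by move=> d u v; rewrite linearPr eps_linear.
- by move=> d x y; rewrite scaler0 addr0.
- by move=> d u v; rewrite scaler0 addr0.
by rewrite -word_cons eps_word_cons.
Qed.

(** With [tensor_Delta_lcons], this compares the two sides of coassociativity at
x u with those at u: they differ by 1 (x) Delta (x u), one part of which is the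
last term here and the other the image of 1 (x) x u. *)
Lemma Delta_tensor_lcons x s :
  tensor_assoc (tensor_map Delta id (lcons_tensor x s))
  = tensor_map (lcons x) id (tensor_assoc (tensor_map Delta id s))
    + tensor e (lcons_tensor x s).
Proof.
move: s; apply: eq_linear_tensor; [linearity|linearity|] => u v.
rewrite lcons_tensorE !tensor_mapE; [|linearity|linearity|linearity|linearity].
rewrite Delta_lcons [tensor (_ + _) _]linearDl linearD /=.
congr (_ + _); last exact: tensor_assocE.
move: (Delta << u >>); apply: eq_linear_tensor; [linearity|linearity|] => p q.
rewrite lcons_tensorE; apply: etrans (tensor_assocE _ _ _) _.
apply/esym; apply: etrans (congr1 _ (tensor_assocE _ _ _)) _.
by apply: tensor_mapE; linearity.
Qed.

Lemma tensor_Delta_lcons x s :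
  tensor_map id Delta (lcons_tensor x s)
  = tensor_map (lcons x) id (tensor_map id Delta s).
Proof.
move: s; apply: eq_linear_tensor; [linearity|linearity|] => u v.
by rewrite lcons_tensorE !tensor_mapE //; linearity.
Qed.

Lemma prefix_rules_coalgebra : is_coalgebra Delta eps.
Proof.
have epsZ (y : H) : linear (fun z : H => eps y *: z) by linearity.
have epsZl (y : H) : linear (fun z : H => eps z *: y).
  exact: (@linear_scalel _ _ _ eps y eps_linear).
have [_ indl _] := @tensor_universal k B B H (fun y z => eps y *: z) epsZl epsZ.
have [_ indr _] := @tensor_universal k B B H (fun y z => eps z *: y) epsZ epsZl.
split; [exact: linearP | exact: eps_linear | | |];
  apply: eq_linear_words; [linearity|linearity|
    |linearity|linearity| |linearity|linearity|];
  elim=> [|a w IHw]; rewrite ?word_nil ?word_cons ?Delta1 ?Delta_lcons.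
- by rewrite !tensor_mapE ?Delta1 ?tensor_assocE //; linearity.
- rewrite !linearD /= Delta_tensor_lcons tensor_Delta_lcons IHw.
  rewrite !tensor_mapE; [|linearity|linearity|linearity|linearity].
  by rewrite Delta1 tensor_assocE Delta_lcons linearDr addrA.
- by rewrite indl eps1 scale1r.
- rewrite linearD /= indl eps1 scale1r -[RHS]add0r; congr (_ + _).
  have l0 : linear (fun _ : HH => 0 : H) by move=> d x y; rewrite scaler0 addr0.
  move: (Delta _); apply: eq_linear_tensor; [linearity|exact: l0|] => u v.
  by rewrite lcons_tensorE indl eps_lcons scale0r.
- by rewrite indr eps1 scale1r.
- rewrite linearD /= indr eps_lcons scale0r addr0 -[in RHS]IHw.
  move: (Delta _); apply: eq_linear_tensor; [linearity|linearity|] => u v.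
  by rewrite lcons_tensorE !indr linearZr_LR.
Qed.

Section Product.
Variables (c : k) (dia : {bilinear X -> X -> X}) (m : H -> H -> H).
Hypothesis m_bilinear : bilinear_for *:%R *:%R m.
HB.instance Definition _ :=
  bilinear_isBilinear.Build k H H H *:%R *:%R m m_bilinear.
Hypothesis diaA : associative dia.
Hypothesis m1x : left_id e m.
Hypothesis mx1 : right_id e m.
Hypothesis m_word_cons : forall a b u v,
  m (word (a :: u)) (word (b :: v)) =
    lcons << a >> (m (word u) (word (b :: v)))
    + lcons << b >> (m (word (a :: u)) (word v))
    + c *: lcons (dia << a >> << b >>) (m (word u) (word v)).

Lemma m_lcons x y u v :
  m (lcons x u) (lcons y v) =
    lcons x (m u (lcons y v)) + lcons y (m (lcons x u) v)
    + c *: lcons (dia x y) (m u v).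
Proof.
move: x u; apply: eq_bilinear_lcons => [u|x|u|x|a u];
  [linearity|linearity|linearity|linearity|].
move: y v; apply: eq_bilinear_lcons => [v|y|v|y|b v];
  [linearity|linearity|linearity|linearity|].
by rewrite -!word_cons m_word_cons.
Qed.

(** Expanding both sides gives terms starting with x, y, z, x <> y, x <> z,
y <> z and x <> y <> z.  What follows such a letter is a product of three
factors, at least one of them shorter than before: one of the products in the
hypotheses. *)
Lemma mA_lcons x y z u v w :
    let xu := lcons x u in let yv := lcons y v in let zw := lcons z w in
    m u (m yv zw) = m (m u yv) zw -> m u (m yv w) = m (m u yv) w ->
    m u (m v zw) = m (m u v) zw -> m u (m v w) = m (m u v) w ->
    m xu (m v zw) = m (m xu v) zw -> m xu (m v w) = m (m xu v) w ->
    m xu (m yv w) = m (m xu yv) w ->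
  m xu (m yv zw) = m (m xu yv) zw.
Proof.
move=> xu yv zw h1 h2 h3 h4 h5 h6 h7.
(* The expansion of the left-hand side, collected by the letter in front. *)
transitivity (lcons x (m u (m yv zw)) + lcons y (m xu (m v zw))
  + lcons z (m xu (m yv w)) + c *: lcons (dia x y) (m u (m v zw))
  + c *: lcons (dia x z) (m u (m yv w)) + c *: lcons (dia y z) (m xu (m v w))
  + c *: (c *: lcons (dia x (dia y z)) (m u (m v w)))).
  rewrite [m yv zw]m_lcons !linearDr !linearZr_LR /= !m_lcons !scalerDr.
  by rewrite [LHS](AC (3*3*3)%AC ((1*4*7)*2*5*3*6*8*9)%AC).
(* The middle sum is now bracketed as the right-hand side. *)
rewrite h1 h2 h3 h4 h5 h6 h7 diaA [m xu yv]m_lcons !linearDl !linearZl_LR /=.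
rewrite !m_lcons !linearDr !linearZr_LR /= !scalerDr.
by rewrite [RHS](AC (3*3*3)%AC (1*4*(2*5*8)*7*3*6*9)%AC).
Qed.

Lemma mA : associative m.
Proof.
move=> x y z; move: x y.
apply: eq_bilinear_words => [y|x|y|x|u v];
  [linearity|linearity|linearity|linearity|].
move: z; apply: eq_linear_words; [linearity|linearity|].
elim: u v => [|a u IHu] v w; first by rewrite word_nil !m1x.
elim: v w => [|b v IHv] w; first by rewrite word_nil m1x mx1.
elim: w => [|d w IHw]; first by rewrite word_nil !mx1.
rewrite !word_cons; apply: mA_lcons; rewrite -?word_cons;
  [exact: IHu | exact: IHu | exact: IHu | exact: IHu
  | exact: IHv | exact: IHv | exact: IHw].
Qed.

Lemma tensor_mul_lcons x y s t :
  tensor_mul m (lcons_tensor x s) (lcons_tensor y t) =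
    lcons_tensor x (tensor_mul m s (lcons_tensor y t))
    + lcons_tensor y (tensor_mul m (lcons_tensor x s) t)
    + c *: lcons_tensor (dia x y) (tensor_mul m s t).
Proof.
move: s; apply: eq_linear_tensor; [linearity|linearity|] => u v.
move: t; apply: eq_linear_tensor; [linearity|linearity|] => u' v'.
by rewrite !(lcons_tensorE, tensor_mulE) /= m_lcons !linearDl linearZl_LR.
Qed.

Lemma tensor_mul_lconsl x s v :
  tensor_mul m (lcons_tensor x s) (tensor e v) =
  lcons_tensor x (tensor_mul m s (tensor e v)).
Proof.
move: s; apply: eq_linear_tensor; [linearity|linearity|] => u w.
rewrite lcons_tensorE 2!tensor_mulE lcons_tensorE /= !mx1; reflexivity.
Qed.

Lemma tensor_mul_lconsr x s v :
  tensor_mul m (tensor e v) (lcons_tensor x s) =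
  lcons_tensor x (tensor_mul m (tensor e v) s).
Proof.
move: s; apply: eq_linear_tensor; [linearity|linearity|] => u w.
rewrite lcons_tensorE 2!tensor_mulE lcons_tensorE /= !m1x; reflexivity.
Qed.

Lemma tensor_mul1x s : tensor_mul m (tensor e e) s = s.
Proof.
move: s; apply: eq_linear_tensor; [linearity|linearity|] => u w.
rewrite tensor_mulE /= !m1x; reflexivity.
Qed.

Lemma tensor_mulx1 s : tensor_mul m s (tensor e e) = s.
Proof.
move: s; apply: eq_linear_tensor; [linearity|linearity|] => u w.
rewrite tensor_mulE /= !mx1; reflexivity.
Qed.

(** Both sides have the same terms once grouped by the letter that prefixes the
left tensor factor; the group without such a letter is 1 (x) (u . v). *)
Lemma DeltaM u v : Delta (m u v) = tensor_mul m (Delta u) (Delta v).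
Proof.
move: u v; apply: eq_bilinear_words => [v|u|v|u|u v];
  [linearity|linearity|linearity|linearity|].
elim: u v => [|a u IHu] v; first by rewrite word_nil Delta1 m1x tensor_mul1x.
elim: v => [|b v IHv]; first by rewrite word_nil Delta1 mx1 tensor_mulx1.
rewrite !word_cons; set x := << a >>; set y := << b >>.
transitivity (lcons_tensor x (Delta (m (word u) (lcons y (word v))))
  + lcons_tensor y (Delta (m (lcons x (word u)) (word v)))
  + c *: lcons_tensor (dia x y) (Delta (m (word u) (word v)))
  + tensor e (m (lcons x (word u)) (lcons y (word v)))).
  rewrite m_lcons !linearD !linearZ /= !Delta_lcons !linearDr.
  by rewrite !linearZr_LR !scalerDr (AC (2*2*2)%AC (1*3*5*(2*4*6))%AC).
rewrite -!word_cons IHv !IHu !word_cons !Delta_lcons !linearDl !linearDr /=.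
rewrite tensor_mul_lcons tensor_mul_lconsl tensor_mul_lconsr tensor_mulE /= m1x.
by rewrite [LHS](AC (2*2*1*1)%AC (1*3*5*2*(4*6))%AC).
Qed.

Lemma epsM u v : eps (m u v) = eps u * eps v.
Proof.
move: u v; apply: (@eq_bilinear_words k^o (fun u v => eps (m u v))
    (fun u v => eps u * eps v)) => [v|u|v|u|u v].
- by move=> d x y; rewrite linearPl eps_linear.
- by move=> d x y; rewrite linearPr eps_linear.
- by move=> d x y; rewrite eps_linear mulrDl -mulrA.
- by move=> d x y; rewrite eps_linear mulrDr mulrCA.
case: u => [|a u]; first by rewrite word_nil m1x eps1 mul1r.
case: v => [|b v]; first by rewrite word_nil mx1 eps1 mulr1.
have epsD x y : eps (x + y) = eps x + eps y.
  by rewrite -[x]scale1r eps_linear scale1r mul1r.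
rewrite !word_cons m_lcons -linearZl_LR !epsD !eps_lcons.
by rewrite !addr0 mulr0.
Qed.

Lemma prefix_rules_bialgebra : is_bialgebra m e Delta eps.
Proof.
split; [|exact: prefix_rules_coalgebra|exact: DeltaM|exact: Delta1
  |exact: epsM|exact: eps1].
split; [| |exact: mA|exact: m1x|exact: mx1].
  by move=> y d u v; exact: linearPl.
by move=> x; exact: linearPr.
Qed.

(** The convolution of f and g on words, by recursion on the word so that it
matches the prefix rule of Delta. *)
Fixpoint conv (f g : seq I -> H) (w : seq I) : H :=
  m (f [::]) (g w)
  + (if w is a :: w' then conv (fun v => f (a :: v)) g w' else 0).

Lemma eq_conv f f' g g' w : (forall v, f v = f' v) ->
    (forall v, (size v <= size w)%N -> g v = g' v) ->
  conv f g w = conv f' g' w.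
Proof.
elim: w f f' => [|a w IHw] f f' ff gg /=; rewrite ff gg //.
by congr (_ + _); apply: IHw => // v le_vw; apply/gg/leqW.
Qed.

Lemma convE (f g : H -> H) w : linear f -> linear g ->
  tensor_ind m (tensor_map f g (Delta (word w)))
  = conv (fun v => f (word v)) (fun v => g (word v)) w.
Proof.
move=> + lg; elim: w f => [|a w IHw] f lf /=.
  by rewrite word_nil Delta1 tensor_mapE // tensor_indE /= addr0.
rewrite word_cons Delta_lcons !linearD /= tensor_mapE // tensor_indE /= addrC.
rewrite word_nil; congr (_ + _).
have lf' : linear (fun u => f (lcons << a >> u)) by linearity.
rewrite (eq_conv (f' := fun v => f (lcons << a >> (word v)))
  (g' := fun v => g (word v))) => [|v|//]; last by rewrite word_cons.
apply: etrans (IHw _ lf'); apply: (congr1 (tensor_ind m)).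
move: (Delta _); apply: eq_linear_tensor; [linearity|linearity|] => u v.
rewrite lcons_tensorE (tensor_mapE _ _ lf lg) (tensor_mapE _ _ lf' lg).
reflexivity.
Qed.

Lemma conv_addl f f' g w :
  conv (fun v => f v + f' v) g w = conv f g w + conv f' g w.
Proof.
elim: w f f' => [|a w IHw] f f' /=; first by rewrite !addr0 linearDl.
by rewrite IHw linearDl addrACA.
Qed.

Lemma conv_mull x f g w : conv (fun v => m x (f v)) g w = m x (conv f g w).
Proof.
elim: w f => [|a w IHw] f /=; first by rewrite !addr0 mA.
by rewrite IHw -mA linearDr.
Qed.

Lemma convA f g h w : conv f (conv g h) w = conv (conv f g) h w.
Proof.
elim: w f g => [|a w IHw] f g /=; first by rewrite !addr0 mA.
by rewrite conv_addl conv_mull IHw addr0 linearDr /= mA addrA.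
Qed.

(** The unit of convolution, that is the counit followed by the unit. *)
Definition conv1 (w : seq I) : H := if w is [::] then e else 0.

Lemma conv1l f w : conv conv1 f w = f w.
Proof.
have conv0 g v : conv (fun _ => 0) g v = 0.
  by elim: v => [|b v IHv] /=; rewrite ?IHv linear0l !addr0.
by case: w => [|a w] /=; rewrite m1x ?conv0 addr0.
Qed.

Lemma conv1r f w : conv f conv1 w = f w.
Proof.
elim: w f => [|a w IHw] f /=; first by rewrite mx1 addr0.
by rewrite IHw linear0r add0r.
Qed.

(** Put h = g * f (convolution), where f * g = 1.  Then f * h = (f * g) * f = f.
If h agrees with the unit on all words shorter than a nonempty w, then, as f is
1 at the empty word, (f * h) w is h w + f w, so that h w = 0. *)
Lemma conv_left_inverse f g : f [::] = e -> (forall w, conv f g w = conv1 w) ->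
  forall w, conv g f w = conv1 w.
Proof.
move=> f1 fg w; have [n] := ubnP (size w); elim: n w => // n IHn [|a w] /=.
  by move=> _; have /= := fg [::]; rewrite f1 m1x mx1.
rewrite ltnS => le_wn.
have gf : conv (fun v => f (a :: v)) (conv g f) w = f (a :: w).
  rewrite -[RHS](conv1r (fun v => f (a :: v))); apply: eq_conv => // v le_vw.
  exact/IHn/(leq_ltn_trans le_vw).
have fgf : conv (conv f g) f (a :: w) = f (a :: w).
  by rewrite -[RHS]conv1l; apply: eq_conv.
have := convA f g f (a :: w); rewrite fgf /= gf f1 m1x.
by move/(canRL (addrK _)); rewrite subrr.
Qed.

(** With r = a_i ... a_1 the reversal of a word, this is the sum over j <= i of
- (-c)^(i - j) (a_(j+1) <> ... <> a_i <> x) (S(a_1 ... a_j) . v): the letter x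
closes a block that may extend over further letters of r. *)
Fixpoint antipode_tail (x : X) (r : seq I) (v : H) : H :=
  if r is a :: r' then
    - lcons x (m (antipode_tail << a >> r' e) v)
    - c *: antipode_tail (dia << a >> x) r' v
  else - lcons x v.

(** The value of the antipode on the reversal of r. *)
Definition antipode_rev (r : seq I) : H :=
  if r is a :: r' then antipode_tail << a >> r' e else e.

(** The product rule, applied to each term of the sum over blocks: the new
letter y comes after the block, comes before it, or is absorbed by it. *)
Lemma antipode_tail_lcons x r y v :
  m (antipode_tail x r e) (lcons y v) =
    antipode_tail x r (lcons y v) + lcons y (m (antipode_tail x r e) v)
    + c *: antipode_tail (dia x y) r v.
Proof.
elim: r x => [|a r IHr] x /=.
  by rewrite !linearNl /= m_lcons !m1x linearNr scalerN !opprD.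
rewrite mx1 !linearBl !linearNl !linearZl_LR /= m_lcons.
rewrite (IHr (dia << a >> x)).
rewrite !linearBr !linearNr !linearZr_LR /= diaA.
rewrite !scalerDr !scalerN !opprD.
by rewrite [LHS](AC (3*3)%AC ((1*4)*(2*5)*(3*6))%AC).
Qed.

(** The telescoping identity: the last two terms of [antipode_tail_lcons] are
together the block sum in which y starts a block of its own or joins the last
one. *)
Lemma antipode_rev_lcons r y v :
  m (antipode_rev r) (lcons y v) =
    (if r is a :: r' then antipode_tail << a >> r' (lcons y v) else 0)
    - antipode_tail y r v.
Proof.
case: r => [|a r] /=; first by rewrite m1x opprK add0r.
by rewrite antipode_tail_lcons opprB opprK addrA addrAC -addrA.
Qed.

(** The sum of S(u_1 u) . v over the factorizations u v = w, where r is the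
reversal of u_1; letting u_1 vary makes the telescoping an induction on w. *)
Lemma conv_antipode_rev r w :
  conv (fun u => antipode_rev (catrev u r)) word w =
    if r is a :: r' then antipode_tail << a >> r' (word w) else conv1 w.
Proof.
elim: w r => [|b w IHw] r /=.
  by rewrite word_nil mx1 addr0; case: r.
rewrite (IHw (b :: r)) word_cons antipode_rev_lcons subrK.
by case: r.
Qed.

Theorem prefix_rules_hopf (S : H -> H) : linear S ->
  (forall w, S (word w) = antipode_rev (rev w)) ->
  is_hopf_algebra m e Delta eps S.
Proof.
move=> lS SE; have Sl w : conv (fun v => S (word v)) word w = conv1 w.
  by apply: etrans (conv_antipode_rev [::] w); apply: eq_conv.
have lid : linear (fun x : H => x) by linearity.
have epsE w : eps (word w) *: e = conv1 w.
  case: w => [|a w]; first by rewrite word_nil eps1 scale1r.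
  by rewrite word_cons eps_lcons scale0r.
have epsl : linear (fun x => eps x *: e).
  exact: (@linear_scalel _ _ _ eps e eps_linear).
split; [exact: prefix_rules_bialgebra|exact: lS| |];
  apply: eq_linear_words; [linearity|exact: epsl| |linearity|exact: epsl|] => w;
  rewrite convE // epsE //.
by apply: conv_left_inverse.
Qed.
End Product.
End Coproduct.
End PrefixRules.

(** * Quasi-shuffle algebras *)

Section Words.
Context {k : fieldType} {A : countType}.
Local Notation kA := {malg k[A]}.
Local Notation kw := {malg k[{fmonom A}]}.
Local Notation wd w := (<< FMonom w >> : kw).

HB.instance Definition _ :=
  GRing.isLinear.Build k kA kw *:%R (@letters k A) (lin_ext_linear _).
HB.instance Definition _ (f : seq A -> seq A -> kw) :=
  bilinear_isBilinear.Build k kw kw kw *:%R *:%R (word_bilin f)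
    (lin_ext2_bilinear (fun w v : {fmonom A} => f w v)).
HB.instance Definition _ :=
  GRing.isLinear.Build k kw _ *:%R (@deconc k A) (lin_ext_linear _).
HB.instance Definition _ :=
  GRing.isLinear.Build k kw kw *:%R (@qs_T k A) (lin_ext_linear _).
HB.instance Definition _ :=
  GRing.isLinear.Build k kw kw *:%R (@qs_R k A) (lin_ext_linear _).
HB.instance Definition _ dia :=
  GRing.isLinear.Build k kw kw *:%R (@qs_Sigma k A dia) (lin_ext_linear _).

Lemma malg_scaler (c : k) (x y : kw) : x * (c *: y) = c *: (x * y).
Proof.
apply/malgP=> w; pose d := (msupp y `|` msupp (c *: y))%fset.
have le1 := fsubset_refl (msupp x).
have le2 : (msupp (c *: y) `<=` d)%fset := fsubsetUr _ _.
have le3 : (msupp y `<=` d)%fset := fsubsetUl _ _.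
apply: etrans (mcoeffMlw w le1 le2) _; rewrite mcoeffZ.
apply/esym/(etrans (congr1 ( *%R c) (mcoeffMlw w le1 le3))).
rewrite mulr_sumr.
apply: eq_bigr => u _; rewrite mulr_sumr; apply: eq_bigr => v _.
by rewrite mcoeffZ mulrnAr mulrCA.
Qed.

Definition prepend (x : kA) (u : kw) : kw := letters x * u.

Lemma prepend_bilinear : bilinear_for *:%R *:%R prepend.
Proof.
split=> [u|x] c y z; rewrite /prepend.
  by rewrite linearP mulrDl /= scalerAl.
by rewrite /= -malg_scaler -mulrDr.
Qed.
HB.instance Definition _ :=
  bilinear_isBilinear.Build k kA kw kw *:%R *:%R prepend prepend_bilinear.

Lemma prepend_word a w : prepend << a >> (wd w) = wd (a :: w).
Proof. by rewrite /prepend /letters lin_extU word_cons. Qed.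

Lemma counit_linear : scalar (@word_counit k A).
Proof. by move=> c x y; rewrite /word_counit mcoeffD mcoeffZ. Qed.

Lemma counit_prepend (x : kA) (u : kw) : word_counit (prepend x u : kw) = 0.
Proof.
rewrite /word_counit /prepend rmorphM /=.
suff -> : (letters x : kw)@_mone = 0 by rewrite mul0r.
rewrite /letters /lin_ext raddf_sum big1 // => a _ /=.
rewrite mcoeffZ mcoeffU; case: eqP => [/(congr1 (@fmonom_val A))|_].
  by rewrite fmuE fm1.
by rewrite mulr0.
Qed.

Lemma counit1 : word_counit (1 : kw) = 1.
Proof. by rewrite /word_counit rmorph1. Qed.

Variable dia : {bilinear kA -> kA -> kA}.
Hypothesis diaA : associative dia.

Lemma qshuffle_word_cons c a b u v :
  word_bilin (qshuffle dia c) (wd (a :: u)) (wd (b :: v)) =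
    prepend << a >> (word_bilin (qshuffle dia c) (wd u) (wd (b :: v)))
    + prepend << b >> (word_bilin (qshuffle dia c) (wd (a :: u)) (wd v))
    + c *: prepend (dia << a >> << b >>)
                 (word_bilin (qshuffle dia c) (wd u) (wd v)).
Proof.
rewrite !word_bilinU /= !/prepend /letters !lin_extU.
reflexivity.
Qed.

Lemma deconc_one : deconc (1 : kw) = tensor 1 1.
Proof.
by rewrite word_one /deconc lin_extU big_ord_recl big_ord0 addr0 tensorU.
Qed.

Lemma deconc_word_cons a w :
  deconc (wd (a :: w)) =
  lcons_tensor prepend << a >> (deconc (wd w)) + tensor 1 (wd (a :: w)).
Proof.
rewrite /deconc !lin_extU big_ord_recl /= word_one tensorU addrC; congr (_ + _).
rewrite /lcons_tensor linear_sum; apply: eq_bigr => i _ /=.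
rewrite -!tensorU tensor_mapE; [|linearity|linearity].
by rewrite prepend_word.
Qed.

Lemma qshuffle_hopf c (S : kw -> kw) : linear S ->
  (forall w, S (wd w) =
     antipode_rev prepend 1 c dia (word_bilin (qshuffle dia c)) (rev w)) ->
  is_hopf_algebra (word_bilin (qshuffle dia c)) 1 deconc word_counit S.
Proof.
move=> lS SE.
apply: (@prefix_rules_hopf k _ A prepend 1 (fun w => wd w) _ _ _ _
  deconc word_counit _ _ _ _ _ _ c dia).
- exact: prepend_bilinear.
- by rewrite -word_one.
- by move=> a w; rewrite prepend_word.
- by case=> w; exists w.
- by move=> d x y; exact: linearP.
- exact: deconc_one.
- exact: deconc_word_cons.
- exact: counit_linear.
- exact: counit1.
- by move=> a w; rewrite -prepend_word counit_prepend.
- by split=> x d y z; [exact: linearPl | exact: linearPr].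
- exact: diaA.
- exact/word_bilin1x/qshuffle1w.
- exact/word_bilinx1/qshufflew1.
- exact: qshuffle_word_cons.
- exact: lS.
- exact: SE.
Qed.

(** The sum of I[w] over the compositions I, where x is put in front of w as the
start of the first block: the block either ends or absorbs the next letter. *)
Fixpoint Sigma_from (x : kA) (w : seq A) : kw :=
  if w is a :: w' then
    prepend x (Sigma_from << a >> w') + Sigma_from (dia x << a >>) w'
  else prepend x 1.

(** I[x w] for a linear combination x of letters in place of the first letter;
blocks are nonempty, so the other values of J do not occur. *)
Definition comp_from (x : kA) (J : seq nat) (w : seq A) : kw :=
  if J is i.+1 :: J' then
    prepend (foldl (fun y b => dia y << b >>) x (take i w))
            (comp_act dia J' (drop i w))
  else 0.

Lemma comp_act_cons n a w J : J \in compositions n.+1 ->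
  comp_act dia J (a :: w) = comp_from << a >> J w.
Proof.
rewrite mem_compositions; case: J => [|[|i] J] //= _.
by rewrite /comp_act /= big_cons /prepend.
Qed.

(** A composition of n + 2 either starts with 1, so that the first block ends, or
arises from one of n + 1 by enlarging its first part. *)
Lemma sum_comp_from x w :
  \sum_(J <- compositions (size w).+1) comp_from x J w = Sigma_from x w.
Proof.
elim: w x => [|a w IHw] x.
  by rewrite /= big_seq1 /= /comp_act big_nil.
have compS n : compositions n.+1 = [seq 1%N :: J | J <- compositions n] ++
    flatten [seq if J is i :: J' then [:: i.+1 :: J'] else [::]
            | J <- compositions n] by [].
rewrite (compS (size w).+1) big_cat big_map big_flatten big_map.
rewrite [Sigma_from _ _]/=; congr (_ + _).
  rewrite -[in RHS]IHw linear_sumr big_seq [RHS]big_seq.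
  apply: eq_bigr => J JP; rewrite -(comp_act_cons _ _ JP).
  by rewrite /comp_from take0 drop0.
rewrite -IHw big_seq [RHS]big_seq; apply: eq_bigr => J.
by rewrite mem_compositions; case: J => [|[|i] J] //= _; rewrite big_seq1.
Qed.

Lemma qs_Sigma_cons a w : qs_Sigma dia (wd (a :: w)) = Sigma_from << a >> w.
Proof.
rewrite /qs_Sigma lin_extU -sum_comp_from big_seq [RHS]big_seq.
by apply: eq_bigr => J JP; rewrite -(comp_act_cons _ _ JP).
Qed.

Hypothesis diaC : commutative dia.

(** For c = 1 every block sum carries the sign of the length of the word; for
c = -1 ([antipode_tail_star]) the sign counts the blocks, as T after Sigma does.
The blocks of [antipode_tail] are multiplied in the order of the original word,
those of [Sigma_from] in the order of the reversed one. *)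
Lemma antipode_tail_ast m x r : right_id 1 m ->
  antipode_tail prepend 1 1 dia m x r 1 = (-1) ^+ (size r).+1 *: Sigma_from x r.
Proof.
move=> m1; elim: r x => [|a r IHr] x /=; first by rewrite expr1 scaleN1r.
rewrite m1 !IHr scale1r linearZr_LR (diaC x).
by rewrite [in RHS]exprS mulN1r scaleNr scalerDr opprD.
Qed.

Lemma qs_T_prepend x (u : kw) : qs_T (prepend x u : kw) = - prepend x (qs_T u).
Proof.
move: x u; apply: eq_bilinear => [u|x|u|x|a [w]]; [linearity|linearity| | |].
- by move=> d x y; rewrite linearPl opprD scalerN.
- by move=> d u v; rewrite linearP linearPr opprD scalerN.
rewrite prepend_word /qs_T !lin_extU linearZr_LR /= prepend_word exprS.
by rewrite mulN1r scaleNr.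
Qed.

Lemma antipode_tail_star m x r : right_id 1 m ->
  antipode_tail prepend 1 (-1) dia m x r 1 = qs_T (Sigma_from x r : kw).
Proof.
have T1 : qs_T (1 : kw) = 1 by rewrite word_one /qs_T lin_extU expr0 scale1r.
move=> m1; elim: r x => [|a r IHr] x /=; first by rewrite qs_T_prepend T1.
by rewrite m1 !IHr scaleN1r opprK linearD /= qs_T_prepend diaC.
Qed.

Lemma ast_hopf : is_hopf_algebra (qs_ast dia) 1 deconc word_counit
    (qs_Sigma dia \o qs_T \o qs_R).
Proof.
apply: qshuffle_hopf => [d x y|w]; first by rewrite /= !linearP.
rewrite /= /qs_R lin_extU /qs_T lin_extU linearZ /=.
case: (rev w) => [|a r]; first by rewrite expr0 scale1r -word_one qs_Sigma1.
rewrite qs_Sigma_cons [RHS]antipode_tail_ast //.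
exact/word_bilinx1/qshufflew1.
Qed.

Lemma star_hopf : is_hopf_algebra (qs_star dia) 1 deconc word_counit
    (qs_T \o qs_Sigma dia \o qs_R).
Proof.
apply: qshuffle_hopf => [d x y|w]; first by rewrite /= !linearP.
rewrite /= /qs_R lin_extU.
case: (rev w) => [|a r].
  rewrite -word_one qs_Sigma1 word_one /qs_T lin_extU expr0 scale1r.
  by rewrite -word_one.
rewrite qs_Sigma_cons [RHS]antipode_tail_star //.
exact/word_bilinx1/qshufflew1.
Qed.
End Words.

Theorem theorem4p2 (k : fieldType) (k_contains_Q : [pchar k] =i pred0)
    (A : countType)
    (dia : {bilinear {malg k[A]} -> {malg k[A]} -> {malg k[A]}})
    (diaA : associative dia) (diaC : commutative dia) :
  is_hopf_algebra (qs_ast dia) 1 deconc word_counit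
    (qs_Sigma dia \o qs_T \o qs_R)
  /\ is_hopf_algebra (qs_star dia) 1 deconc word_counit
    (qs_T \o qs_Sigma dia \o qs_R).
Proof. by split; [apply: ast_hopf | apply: star_hopf]. Qed.
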